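(* Let $\ell\ge 1$ and let $\{p_n(x)\}_{n\ge 0}$ be a sequence of polynomials satisfying $p_{n+\ell}(x)=\sum_{j=1}^{\ell}a_j(x)p_{n+\ell-j}(x)$ for $n\ge 0$, where $a_1(x),\dots,a_\ell(x)$ are fixed polynomials and $p_0(x),\dots,p_{\ell-1}(x)$ are prescribed. Let $$P(t,x)=\sum_{n\ge0}p_n(x)t^n=\frac{N(t,x)}{D(t,x)},$$ where $$D(t,x)=1-\sum_{j=1}^{\ell}a_j(x)t^j,\qquad N(t,x)=\sum_{m=0}^{\ell-1}\Bigl(p_m(x)-\sum_{j=1}^{m}a_j(x)p_{m-j}(x)\Bigr)t^m,$$ so that $D(0,x)=1$. Then the following statements are equivalent. (1) There exist formal power series $g(t)$ and $f(t)$, independent of $x$, such that $$P(t,x)=\frac{g(t)}{1-xf(t)},\qquad g(0)\ne 0,\quad f(0)=0,\quad f'(0)\neq 0.$$ (2) There exist formal power series $q(t,x)$, $N_0(t)$, $D_0(t)$, $D_1(t)$ such that $$N(t,x)=q(t,x)N_0(t),\qquad D(t,x)=q(t,x)\bigl(D_0(t)+xD_1(t)\bigr),$$ where $N_0(0)\ne 0$, $D_0(0)\neq 0$, $D_1(0)=0$ and $D_1'(0)\neq 0$. In this case, $$g(t)=\frac{N_0(t)}{D_0(t)},\qquad f(t)=-\frac{D_1(t)}{D_0(t)}.$$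
   Context: All polynomials and formal power series have coefficients in a field $\mathbb K$ of characteristic $0$. Series such as $P(t,x)$ and $q(t,x)$ are formal power series in the indicated variables. *)

(* Defs.v *)
From HB Require Import structures.
From mathcomp Require Import all_boot all_algebra.
From mathcomp Require Import boolp.

Set Implicit Arguments.
Unset Strict Implicit.
Unset Printing Implicit Defensive.

Import GRing.Theory.
Local Open Scope ring_scope.

(* R[[t]]; the coefficient of t^n in f is f n, so f(0) is f 0%N. *)
Record fps (R : Type) := Fps { fps_coef :> nat -> R }.

Lemma fpsP (R : Type) (f g : fps R) : (forall n, f n = g n) <-> f = g.
Proof.
split=> [|-> //]; case: f => f; case: g => g /= fg.
by congr Fps; apply/funext.
Qed.

HB.instance Definition _ (R : Type) := gen_eqMixin (fps R).
HB.instance Definition _ (R : Type) := gen_choiceMixin (fps R).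

Section FpsZmodule.
Variable R : zmodType.
Implicit Types f g : fps R.

Definition fps_zero : fps R := Fps (fun=> 0).
Definition fps_opp f : fps R := Fps (fun n => - f n).
Definition fps_add f g : fps R := Fps (fun n => f n + g n).

Fact fps_addA : associative fps_add.
Proof. by move=> f g h; apply/fpsP => n /=; rewrite addrA. Qed.
Fact fps_addC : commutative fps_add.
Proof. by move=> f g; apply/fpsP => n /=; rewrite addrC. Qed.
Fact fps_add0 : left_id fps_zero fps_add.
Proof. by move=> f; apply/fpsP => n /=; rewrite add0r. Qed.
Fact fps_addN : left_inverse fps_zero fps_opp fps_add.
Proof. by move=> f; apply/fpsP => n /=; rewrite addNr. Qed.

HB.instance Definition _ := GRing.isZmodule.Build (fps R)
  fps_addA fps_addC fps_add0 fps_addN.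
End FpsZmodule.

Section FpsRing.
Variable R : comNzRingType.
Implicit Types f g h : fps R.

Definition fpsC (c : R) : fps R := Fps (fun n => if n == 0%N then c else 0).

Definition fps_mul f g : fps R :=
  Fps (fun n => \sum_(i < n.+1) f i * g (n - i)%N).

Fact fps_mulC : commutative fps_mul.
Proof.
move=> f g; apply/fpsP => n /=; rewrite (reindex_inj rev_ord_inj) /=.
by apply: eq_bigr => j _; rewrite (sub_ordK j) mulrC.
Qed.

Fact fps_mulA : associative fps_mul.
Proof.
move=> f g h; rewrite [fps_mul g h]fps_mulC [RHS]fps_mulC.
apply/fpsP => i /=.
pose coef3 j k := f j * (g (i - j - k)%N * h k).
transitivity (\sum_(j < i.+1) \sum_(k < i.+1 | (k <= i - j)%N) coef3 j k).
  apply: eq_bigr => /= j _; rewrite big_distrr /=.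
  rewrite (big_ord_narrow_leq (leq_subr _ _)) /=.
  by apply: eq_bigr => k _; rewrite /coef3 [h k * _]mulrC.
rewrite (exchange_big_dep predT) //=; apply: eq_bigr => k _.
transitivity (\sum_(j < i.+1 | (j <= i - k)%N) coef3 j k).
  apply: eq_bigl => j; rewrite -ltnS -(ltnS j) -!subSn ?leq_ord //.
  by rewrite -subn_gt0 -(subn_gt0 j) -!subnDA addnC.
rewrite (big_ord_narrow_leq (leq_subr _ _)) /= big_distrr /=.
apply: eq_bigr => j _.
by rewrite /coef3 -!subnDA addnC mulrA [RHS]mulrC.
Qed.

Fact fps_mul1 : left_id (fpsC 1) fps_mul.
Proof.
move=> f; apply/fpsP => n /=; rewrite big_ord_recl /= subn0 mul1r.
by rewrite big1 ?addr0 // => j _; rewrite mul0r.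
Qed.

Fact fps_mulDl : left_distributive fps_mul +%R.
Proof.
move=> f g h; apply/fpsP => n /=; rewrite -big_split.
by apply: eq_bigr => j _; rewrite /= mulrDl.
Qed.

Fact fps_one_neq0 : fpsC 1 != 0.
Proof.
by apply/eqP => /fpsP /(_ 0%N) /= /eqP; rewrite oner_eq0.
Qed.

HB.instance Definition _ := GRing.Zmodule_isComNzRing.Build (fps R)
  fps_mulA fps_mulC fps_mul1 fps_mulDl fps_one_neq0.

Definition fps_unit : {pred fps R} := fun f => `[< exists g, g * f = 1 >].

(* The inverse of f if it exists and f otherwise, as is usual for unit rings.
   Over a field, and over a ring of series over a field, f is invertible
   as soon as its constant coefficient is. *)
Definition fps_inv f : fps R :=
  if pselect (exists g, g * f = 1) is left ex_g then projT1 (cid ex_g) else f.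

Fact fps_mulVx : {in fps_unit, left_inverse 1 fps_inv *%R}.
Proof.
move=> f /asboolP f_unit; rewrite /fps_inv.
by case: pselect => // ex_g; case: cid.
Qed.

Fact fps_unitPl f g : g * f = 1 -> fps_unit f.
Proof. by move=> gf1; apply/asboolP; exists g. Qed.

Fact fps_inv_out : {in [predC fps_unit], fps_inv =1 id}.
Proof.
move=> f /asboolPn f_nunit; rewrite /fps_inv.
by case: pselect.
Qed.

HB.instance Definition _ := GRing.ComNzRing_hasMulInverse.Build (fps R)
  fps_mulVx fps_unitPl fps_inv_out.

Definition fpsX : fps R := Fps (fun n => (n == 1%N)%:R).

Definition fps_deriv f : fps R := Fps (fun n => f n.+1 *+ n.+1).

Definition fps_of_poly (p : {poly R}) : fps R := Fps (fun n => p`_n).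

End FpsRing.

Arguments fpsX {R}.

(* K[[t,x]] as K[[x]][[t]]: the coefficient of t^n x^k in F is F n k. *)
Notation fps2 K := (fps (fps K)).

Section TwoVariables.
Variable K : fieldType.

Definition var_t : fps2 K := fpsX.
Definition var_x : fps2 K := fpsC fpsX.
Definition series_t (g : fps K) : fps2 K := Fps (fun n => fpsC (g n)).
Definition poly_x (p : {poly K}) : fps2 K := fpsC (fps_of_poly p).

(* \sum_(n >= 0) p_n(x) t^n *)
Definition genfun (p : nat -> {poly K}) : fps2 K :=
  Fps (fun n => fps_of_poly (p n)).

Definition denom (l : nat) (a : nat -> {poly K}) : fps2 K :=
  1 - \sum_(1 <= j < l.+1) poly_x (a j) * var_t ^+ j.

Definition numer (l : nat) (a p : nat -> {poly K}) : fps2 K :=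
  \sum_(0 <= m < l)
    poly_x (p m - \sum_(1 <= j < m.+1) a j * p (m - j)%N) * var_t ^+ m.

Definition riordan_form (P : fps2 K) (g f : fps K) : Prop :=
  [/\ P = series_t g / (1 - var_x * series_t f),
      g 0%N != 0, f 0%N = 0 & fps_deriv f 0%N != 0].

Definition common_factor_form (N D q : fps2 K) (N0 D0 D1 : fps K) : Prop :=
  [/\ N = q * series_t N0 /\ D = q * (series_t D0 + var_x * series_t D1),
      N0 0%N != 0, D0 0%N != 0, D1 0%N = 0 & fps_deriv D1 0%N != 0].

End TwoVariables.
Arguments var_t {K}.
Arguments var_x {K}.

(* Main.v *)
Require Import Defs.
From HB Require Import structures.
From mathcomp Require Import all_boot all_algebra.

Set Implicit Arguments.
Unset Strict Implicit.
Unset Printing Implicit Defensive.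

Import GRing.Theory.
Local Open Scope ring_scope.

(** Since [D] has constant coefficient 1 it is invertible, and the recurrence
    says [P = N / D]. If [P = g / (1 - x f)], then [q = D / (1 - x f)] is a
    common factor, with [N0 = g], [D0 = 1] and [D1 = - f]. Conversely [q]
    divides the unit [D], hence cancels in [N / D = N0 / (D0 + x D1)].
    The pair [(g, f)] is determined by the coefficients of [x^0] and [x^1] in
    [g (1 - x f') = g' (1 - x f)]. *)

Section FpsCoef.
Variable R : comNzRingType.
Implicit Types f g : fps R.

Lemma fps_coefD f g n : (f + g) n = f n + g n. Proof. by []. Qed.

Lemma fps_coefN f n : (- f) n = - f n. Proof. by []. Qed.

Lemma fps_coefB f g n : (f - g) n = f n - g n. Proof. by []. Qed.

Lemma fps_coef1 n : (1 : fps R) n = (n == 0%N)%:R.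
Proof. by rewrite /GRing.one /=; case: eqP. Qed.

Lemma fps_coefM f g n : (f * g) n = \sum_(i < n.+1) f i * g (n - i)%N.
Proof. by []. Qed.

Lemma fps_coef0M f g : (f * g) 0%N = f 0%N * g 0%N.
Proof. by rewrite fps_coefM big_ord1. Qed.

Lemma fps_coef_sum I (r : seq I) (P : pred I) (F : I -> fps R) n :
  (\sum_(i <- r | P i) F i) n = \sum_(i <- r | P i) F i n.
Proof. exact: (big_morph (fun f : fps R => f n)). Qed.

Lemma fps_coefCM (c : R) f n : (fpsC c * f) n = c * f n.
Proof.
rewrite fps_coefM big_ord_recl subn0 big1 ?addr0 // => i _.
by rewrite /= mul0r.
Qed.

Lemma fps_coefXM f n : (fpsX * f) n = if n is m.+1 then f m else 0.
Proof.
rewrite fps_coefM; case: n => [|n]; first by rewrite big_ord1 mul0r.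
rewrite !big_ord_recl big1 => [|i _]; last by rewrite mul0r.
by rewrite mul0r mul1r add0r addr0 /= subSS subn0.
Qed.

Lemma fps_coefXnM f j n :
  (fpsX ^+ j * f) n = if (j <= n)%N then f (n - j)%N else 0.
Proof.
elim: j n => [|j IHj] n; first by rewrite mul1r subn0.
by rewrite exprS -mulrA fps_coefXM; case: n => [|n] //; rewrite IHj subSS.
Qed.

(** Each factor [f] raises the order in the variable by at least one. This makes the geometric
    series in [f] a finite sum in every degree. *)
Lemma fps_coef_exp_lt f k n : f 0%N = 0 -> (n < k)%N -> (f ^+ k) n = 0.
Proof.
move=> f0; elim: k n => // k IHk n ltnk.
rewrite exprS fps_coefM big_ord_recl f0 mul0r add0r big1 // => i _.
have n_gt0 := leq_ltn_trans (leq0n i) (ltn_ord i).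
by rewrite IHk ?mulr0 // (@leq_trans n) // lift0 ltn_subrL n_gt0.
Qed.

(* The inverse of [1 - f] is the geometric series, whose coefficient of t^n
   only involves the powers [f ^+ k] with [k <= n]. *)
Lemma fps_subr_unit f : f 0%N = 0 -> 1 - f \is a GRing.unit.
Proof.
move=> f0; pose S n := \sum_(k < n.+1) f ^+ k.
have S_stable n i : (i <= n)%N -> S n i = S i i.
  move=> le_in; rewrite /S !fps_coef_sum.
  rewrite [RHS](big_ord_widen n.+1 (fun k => (f ^+ k) i)) ?ltnS //.
  rewrite [LHS](bigID (fun k : 'I_n.+1 => (k < i.+1)%N)) /=.
  rewrite [X in _ + X]big1 ?addr0 // => k; rewrite -leqNgt.
  exact: fps_coef_exp_lt.
apply/unitrPr; exists (Fps (fun n => S n n)); apply/fpsP => n.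
(* Up to degree [n] the diagonal series agrees with the single partial sum [S n], and
   [(1 - f) * S n] telescopes to [1 - f ^+ n.+1]. *)
transitivity (((1 - f) * S n) n).
  rewrite !fps_coefM; apply: eq_bigr => i _ /=.
  by rewrite (S_stable n) // leq_subr.
by rewrite -opprB mulNr -subrX1 opprB fps_coefB fps_coef_exp_lt // subr0.
Qed.

End FpsCoef.

(** Dividing by the constant coefficient gives a series of the form [1 - h] with [h] vanishing at 0.
    The generality of [R] covers both [K[[t]]] and [K[[x]][[t]]]. *)
Lemma fps_coef0_unit (R : comUnitRingType) (f : fps R) :
  f 0%N \is a GRing.unit -> f \is a GRing.unit.
Proof.
move=> f0U; have h0 : (1 - fpsC (f 0%N)^-1 * f) 0%N = 0.
  by rewrite fps_coefB fps_coefCM mulVr // fps_coef1 subrr.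
by have := fps_subr_unit h0; rewrite subKr unitrM => /andP[].
Qed.

Section FpsMorphisms.
Variable R : comNzRingType.

Fact fpsC_is_zmod_morphism : zmod_morphism (@fpsC R).
Proof. by move=> c d; apply/fpsP => -[|n] //=; rewrite subr0. Qed.

Fact fpsC_is_monoid_morphism : monoid_morphism (@fpsC R).
Proof.
split=> // c d; apply/fpsP => n; rewrite fps_coefCM /=.
by case: eqP; rewrite ?mulr0.
Qed.

HB.instance Definition _ := GRing.isZmodMorphism.Build R (fps R)
  (@fpsC R) fpsC_is_zmod_morphism.
HB.instance Definition _ := GRing.isMonoidMorphism.Build R (fps R)
  (@fpsC R) fpsC_is_monoid_morphism.

Fact fps_of_poly_is_zmod_morphism : zmod_morphism (@fps_of_poly R).
Proof. by move=> u v; apply/fpsP => n; rewrite /= coefB. Qed.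

Fact fps_of_poly_is_monoid_morphism : monoid_morphism (@fps_of_poly R).
Proof.
split=> [|u v]; apply/fpsP => n; first by rewrite /= coef1; case: eqP.
by rewrite /= coefM.
Qed.

HB.instance Definition _ := GRing.isZmodMorphism.Build {poly R} (fps R)
  (@fps_of_poly R) fps_of_poly_is_zmod_morphism.
HB.instance Definition _ := GRing.isMonoidMorphism.Build {poly R} (fps R)
  (@fps_of_poly R) fps_of_poly_is_monoid_morphism.

End FpsMorphisms.

Section TwoVariableSeries.
Variable K : fieldType.
Implicit Types g h : fps K.

Fact series_t_is_zmod_morphism : zmod_morphism (@series_t K).
Proof. by move=> g h; apply/fpsP => n; rewrite /= rmorphB. Qed.

Fact series_t_is_monoid_morphism : monoid_morphism (@series_t K).
Proof.
split=> [|g h]; apply/fpsP => n; first by case: n => [|n] //; exact: rmorph0.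
by rewrite /= rmorph_sum; apply: eq_bigr => i _; rewrite rmorphM.
Qed.

HB.instance Definition _ := GRing.isZmodMorphism.Build (fps K) (fps2 K)
  (@series_t K) series_t_is_zmod_morphism.
HB.instance Definition _ := GRing.isMonoidMorphism.Build (fps K) (fps2 K)
  (@series_t K) series_t_is_monoid_morphism.

Lemma fps_field_unit g : g 0%N != 0 -> g \is a GRing.unit.
Proof. by move=> g0; apply: fps_coef0_unit; rewrite unitfE. Qed.

(** For each [n], the coefficient of t^n is a series in x that is linear; it is read off at x^0 and
    x^1. *)
Lemma series_t_linear_inj g1 h1 g2 h2 :
  series_t g1 + var_x * series_t h1 = series_t g2 + var_x * series_t h2 ->
  g1 = g2 /\ h1 = h2.
Proof.
move=> /fpsP eq_gh; split; apply/fpsP => n; have /fpsP := eq_gh n;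
  rewrite !fps_coefD !fps_coefCM.
- by move=> /(_ 0%N); rewrite !fps_coefD !fps_coefXM !addr0.
- by move=> /(_ 1%N); rewrite !fps_coefD !fps_coefXM !add0r.
Qed.

Lemma riordan_denom_unit (f : fps K) :
  f 0%N = 0 -> 1 - var_x * series_t f \is a GRing.unit.
Proof.
by move=> f0; apply: fps_subr_unit; rewrite fps_coefCM /= f0 rmorph0 mulr0.
Qed.

Lemma denom_coef0 l (a : nat -> {poly K}) : denom l a 0%N = 1.
Proof.
rewrite fps_coefB fps_coef1 fps_coef_sum big_nat big1 ?subr0 // => j.
case/andP=> j_gt0 _; rewrite fps_coefCM -[var_t ^+ j]mulr1 fps_coefXnM.
by rewrite leqNgt j_gt0 mulr0.
Qed.

Lemma denom_unit l (a : nat -> {poly K}) : denom l a \is a GRing.unit.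
Proof. by apply: fps_coef0_unit; rewrite denom_coef0 unitr1. Qed.

Lemma genfun_mul_denom l (a p : nat -> {poly K}) :
  (forall n, p (n + l)%N = \sum_(1 <= j < l.+1) a j * p (n + l - j)%N) ->
  genfun p * denom l a = numer l a p.
Proof.
move=> p_rec; apply/fpsP => n.
(* The filter [j <= n] matters: natural subtraction would turn [p (n - j)] into [p 0] for larger
   [j]. *)
have PDn : (genfun p * denom l a) n =
    fps_of_poly (p n - \sum_(1 <= j < l.+1 | (j <= n)%N) a j * p (n - j)%N).
  rewrite mulrC mulrBl mul1r fps_coefB mulr_suml fps_coef_sum rmorphB rmorph_sum.
  rewrite [in RHS]big_mkcond; congr (_ - _); apply: eq_bigr => j _.
  rewrite -mulrA fps_coefCM fps_coefXnM.
  by case: leqP => _; rewrite ?mulr0 // rmorphM.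
have Nn : numer l a p n = if (n < l)%N then
    fps_of_poly (p n - \sum_(1 <= j < n.+1) a j * p (n - j)%N) else 0.
  rewrite /numer big_mkord fps_coef_sum.
  have coef_term (c : fps K) m :
      (fpsC c * var_t ^+ m) n = if m == n then c else 0.
    rewrite fps_coefCM -[var_t ^+ m]mulr1 fps_coefXnM fps_coef1 subn_eq0.
    by case: ltngtP => _; rewrite ?mulr0 ?mulr1.
  under eq_bigr do rewrite coef_term.
  rewrite -big_mkcond; case: ltnP => [lt_nl | le_ln].
    by rewrite (big_pred1 (Ordinal lt_nl)).
  by rewrite big_pred0 // => i; rewrite ltn_eqF // (leq_trans _ le_ln).
rewrite PDn Nn; case: ltnP => [lt_nl | le_ln].
  congr (fps_of_poly (_ - _)).
  by rewrite [RHS](@big_nat_widen _ _ _ _ _ l.+1) // ltnS ltnW.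
suff -> : p n = \sum_(1 <= j < l.+1 | (j <= n)%N) a j * p (n - j)%N.
  by rewrite subrr rmorph0.
(* This is the recurrence at index [n - l]; since [l <= n], the filter holds for every [j] in the
   range. *)
rewrite -[in LHS](subnK le_ln) p_rec subnK // big_nat [RHS]big_nat_cond.
apply: eq_bigl => j; case: (boolP (0 < j < l.+1)%N) => //= /andP[_].
by rewrite ltnS => /leq_trans ->.
Qed.

End TwoVariableSeries.

Theorem theorem3p1 (K : fieldType) (K_char0 : [pchar K] =i pred0)
    (l : nat) (l_ge1 : (1 <= l)%N) (a p : nat -> {poly K})
    (p_rec : forall n : nat,
       p (n + l)%N = \sum_(1 <= j < l.+1) a j * p (n + l - j)%N) :
  let P := genfun p in
  let N := numer l a p in
  let D := denom l a in
  [/\ P = N / D,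
      D 0%N = 1,
      (exists g f : fps K, riordan_form P g f) <->
      (exists (q : fps2 K) (N0 D0 D1 : fps K),
         common_factor_form N D q N0 D0 D1) &
      forall (g f : fps K) (q : fps2 K) (N0 D0 D1 : fps K),
        riordan_form P g f -> common_factor_form N D q N0 D0 D1 ->
        g = N0 / D0 /\ f = - D1 / D0].
Proof.
move=> P N D; have D_unit : D \is a GRing.unit := denom_unit l a.
have PD : P * D = N := genfun_mul_denom p_rec.
have PE : P = N / D by rewrite -PD mulrK.
have riordan_of_factor q N0 D0 D1 : common_factor_form N D q N0 D0 D1 ->
    riordan_form P (N0 / D0) (- D1 / D0).
  case=> -[NE DE] N00 D00 D10 D1'0; have D0U := fps_field_unit D00.
  have D0V0 : D0^-1 0%N * D0 0%N = 1.
    by rewrite -fps_coef0M mulVr.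
  have D0V0_neq0 : D0^-1 0%N != 0.
    by apply: contra_eq_neq D0V0 => ->; rewrite mul0r eq_sym oner_eq0.
  have f0 : (- D1 / D0) 0%N = 0 by rewrite fps_coef0M fps_coefN D10 oppr0 mul0r.
  split=> //; last 1 first.
  (* By the product rule and [D1 0 = 0], only the term [- D1 1 * D0^-1 0] survives in the
     coefficient of t. *)
  - rewrite /= mulr1n !big_ord_recl big_ord0 /= addr0 D10 oppr0 mul0r add0r.
    by rewrite mulf_neq0 // oppr_eq0; move: D1'0; rewrite /= mulr1n.
  - have factorE : series_t D0 + var_x * series_t D1 =
        series_t D0 * (1 - var_x * series_t (- D1 / D0)).
      rewrite mulNr rmorphN mulrN opprK mulrDr mulr1 mulrCA -rmorphM.
      by rewrite mulrCA mulrV // mulr1.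
    have qU : q \is a GRing.unit.
      by move: D_unit; rewrite DE unitrM => /andP[].
    (* Denominators are cleared by multiplying with three units: the Riordan denominator, [q] and
       [D0]. What remains follows from [P * D = N]. *)
    apply: (mulIr (riordan_denom_unit f0)); rewrite divrK ?riordan_denom_unit //.
    apply: (mulrI qU); apply: (mulIr (rmorph_unit (@series_t K) D0U)).
    rewrite -[RHS]mulrA -rmorphM divrK // -NE -PD DE factorE.
    by rewrite -!mulrA [RHS]mulrCA [in RHS](mulrC (series_t D0)).
  - by rewrite fps_coef0M mulf_neq0.
split=> //; first exact: denom_coef0.
  split=> [[g [f [PE' g0 f0 f'0]]]|[q [N0 [D0 [D1 NDE]]]]]; last first.
    by exists (N0 / D0), (- D1 / D0); apply: riordan_of_factor NDE.
  exists (D / (1 - var_x * series_t f)), g, 1, (- f); split=> //.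
  - split; first by rewrite -PD PE' mulrC mulrA mulrAC.
    by rewrite rmorph1 rmorphN mulrN divrK ?riordan_denom_unit.
  - by rewrite fps_coef1 oner_eq0.
  - by rewrite fps_coefN f0 oppr0.
  - by move: f'0; rewrite /= !mulr1n oppr_eq0.
move=> g f q N0 D0 D1 [PE' g0 f0 _] /riordan_of_factor.
(* The explicit quotients are generalised: it suffices that two pairs representing the same [P]
   coincide. *)
move: (N0 / D0) (- D1 / D0) => g' f' [PE'' _ f'0 _].
have gE := divrK (riordan_denom_unit f0) (series_t g).
have g'E := divrK (riordan_denom_unit f'0) (series_t g').
have cross : series_t g + var_x * series_t (- (g * f')) =
    series_t g' + var_x * series_t (- (g' * f)).
  have expand u v : series_t u + var_x * series_t (- (u * v)) =
      series_t u * (1 - var_x * series_t v) :> fps2 K.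
    by rewrite mulrBr mulr1 rmorphN rmorphM mulrN mulrCA.
  by rewrite !expand -gE -g'E -PE' -PE'' mulrAC.
(* The x^0 part gives [g = g'], the x^1 part [g * f' = g' * f]; then [g] cancels because [g 0] is
   nonzero. *)
have [gg' /oppr_inj] := series_t_linear_inj cross.
by rewrite -gg' => /(mulrI (fps_field_unit g0)).
Qed.
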